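(* If $G$ is a connected graph with $n\geq 2$ vertices, then \[H(G)\leq GA(G)\leq (n-1)H(G).\] The lower bound is attained if and only if $G\cong P_{2}$, and the upper bound is attained if and only if $G\cong K_{n}$.
   Context: Graphs are finite and simple, with vertex set $V(G)=\{v_1,\dots,v_n\}$ and edge set $E(G)$. $d_i$ is the degree of the vertex $v_i$, and $ij$ denotes the edge joining $v_i$ and $v_j$. The harmonic index is $H(G)=\sum_{ij\in E(G)}\frac{2}{d_i+d_j}$ and the first geometric-arithmetic index is $GA(G)=\sum_{ij\in E(G)}\frac{\sqrt{d_id_j}}{\frac12(d_i+d_j)}$. $P_k$ and $K_k$ denote the path and the complete graph on $k$ vertices. *)

(* Defs.v *)
From mathcomp Require Import all_boot all_order all_algebra.

Set Implicit Arguments.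
Unset Strict Implicit.
Unset Printing Implicit Defensive.

Import Order.TTheory GRing.Theory Num.Theory.
Local Open Scope ring_scope.

Record sgraph := SGraph {
  vertex :> finType;
  adj : rel vertex;
  adj_sym : symmetric adj;
  adj_irrefl : irreflexive adj
}.

Definition edges (G : sgraph) : {set {set G}} :=
  [set e : {set G} | [exists x, exists y, adj x y && (e == [set x; y])]].

Definition deg (G : sgraph) (x : G) : nat := #|[set y : G | adj x y]|.

Definition is_connected (G : sgraph) : Prop :=
  forall x y : G, connect (@adj G) x y.

Definition isomorphic (G1 G2 : sgraph) : Prop :=
  exists2 f : G1 -> G2, bijective f & {mono f : x y / adj x y}.

(* An edge e is a two-element set {i, j}, so that d_i + d_j and d_i * d_j are
   the sum and the product of the degrees of the elements of e. *)
Definition harmonic (R : rcfType) (G : sgraph) : R :=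
  \sum_(e in edges G) 2 / (\sum_(v in e) (deg v)%:R).

Definition geom_arith (R : rcfType) (G : sgraph) : R :=
  \sum_(e in edges G)
    Num.sqrt (\prod_(v in e) (deg v)%:R) / (2^-1 * \sum_(v in e) (deg v)%:R).

Definition path_adj (k : nat) : rel 'I_k :=
  fun i j => (i.+1 == j :> nat) || (j.+1 == i :> nat).

Lemma path_adj_sym (k : nat) : symmetric (@path_adj k).
Proof. by move=> i j; rewrite /path_adj orbC. Qed.

Lemma path_adj_irrefl (k : nat) : irreflexive (@path_adj k).
Proof. by move=> i; rewrite /path_adj orbb gtn_eqF. Qed.

Definition path_graph (k : nat) : sgraph :=
  SGraph (@path_adj_sym k) (@path_adj_irrefl k).

Definition complete_adj (k : nat) : rel 'I_k := fun i j => i != j.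

Lemma complete_adj_sym (k : nat) : symmetric (@complete_adj k).
Proof. by move=> i j; rewrite /complete_adj eq_sym. Qed.

Lemma complete_adj_irrefl (k : nat) : irreflexive (@complete_adj k).
Proof. by move=> i; rewrite /complete_adj eqxx. Qed.

Definition complete_graph (k : nat) : sgraph :=
  SGraph (@complete_adj_sym k) (@complete_adj_irrefl k).

(* Main.v *)
Require Import Defs.
From mathcomp Require Import all_boot all_order all_algebra.

Set Implicit Arguments.
Unset Strict Implicit.
Unset Printing Implicit Defensive.

Import Order.TTheory GRing.Theory Num.Theory.
Local Open Scope ring_scope.

(** Each edge [xy] contributes [2 / (d_x + d_y)] to the harmonic index and
    [sqrt (d_x d_y)] times as much to the geometric-arithmetic index.  The two
    degrees lie between [1] and [n - 1], hence so does their geometric mean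
    [sqrt (d_x d_y)], and summing over the edges gives both inequalities.

    Geometric means of positive numbers are strictly monotone, so a bound is
    attained exactly when both ends of every edge have the extreme degree
    ([harmonic_leif], [geom_arith_leif]).  A connected graph with at least two
    vertices has no isolated vertex, so this says that every vertex has that
    degree ([forall_edges]).  If it is [n - 1], every vertex is adjacent to all
    others, and the graph is [K_n] ([isomorphic_completeP]).  If it is [1], two
    adjacent vertices form a whole connected component, so [n = 2]
    ([card_connected_deg1]); then [1 = n - 1], and the previous case applies
    because [P_2] and [K_2] have the same adjacency relation. *)

(** The equality case is what needs the lower factors to be positive: otherwise
    [a * b = c * d = 0] is possible with [a < c]. *)
Lemma sqrt_mul_leif (R : rcfType) (a b c d : R) :
  0 < a -> 0 < b -> a <= c -> b <= d ->
  Num.sqrt (a * b) <= Num.sqrt (c * d) ?= iff (a == c) && (b == d).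
Proof.
move=> a0 b0 ac bd; have c0 := lt_le_trans a0 ac; have d0 := lt_le_trans b0 bd.
have [le_ab eq_ab] := leif_pM (ltW a0) (ltW b0) (leif_eq ac) (leif_eq bd).
split; first by rewrite ler_wsqrtr.
by rewrite eqr_sqrt ?mulr_ge0 ?ltW // eq_ab gt_eqF ?mulr_gt0.
Qed.

Lemma edgeP (G : sgraph) (e : {set G}) :
  reflect (exists x, exists2 y, adj x y & e = [set x; y]) (e \in edges G).
Proof.
rewrite inE; apply: (iffP existsP) => [[x /existsP[y /andP[xy /eqP->]]]|].
  by exists x, y.
by case=> x [y xy ->]; exists x; apply/existsP; exists y; rewrite xy eqxx.
Qed.

Lemma adj_neq (G : sgraph) (x y : G) : adj x y -> x != y.
Proof. by apply: contraTneq => ->; rewrite adj_irrefl. Qed.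

Lemma neighbours_subset (G : sgraph) (x : G) :
  [set y | adj x y] \subset [set~ x].
Proof. by apply/subsetP=> y; rewrite !inE eq_sym => /adj_neq. Qed.

Lemma deg_gt0 (G : sgraph) (x y : G) : adj x y -> (0 < deg x)%N.
Proof. by move=> xy; apply/card_gt0P; exists y; rewrite inE. Qed.

Lemma deg_le (G : sgraph) (x : G) : (deg x <= #|G|.-1)%N.
Proof. by rewrite -(cardsC1 x) subset_leq_card ?neighbours_subset. Qed.

Lemma connected_neighbour (G : sgraph) (x : G) :
  is_connected G -> (2 <= #|G|)%N -> exists y, adj x y.
Proof.
move=> conn G2; have /card_gt0P[y] : (0 < #|[set~ x]|)%N.
  by rewrite cardsC1 -subn1 subn_gt0.
rewrite !inE => yx; have /connectP[[|z p] /=] := conn x y.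
  by move=> _ y_x; rewrite y_x eqxx in yx.
by case/andP=> xz _ _; exists z.
Qed.

(** By connectedness every vertex lies on an edge, so a condition on the ends of
    all edges is a condition on all vertices. *)
Lemma forall_edges (G : sgraph) (P : pred G) :
  is_connected G -> (2 <= #|G|)%N ->
  reflect (forall x, P x) [forall (e | e \in edges G), [forall v in e, P v]].
Proof.
move=> conn G2; apply: (iffP forall_inP) => [Pe x | Px e _].
  2: exact/forall_inP.
have [y xy] := connected_neighbour x conn G2.
have /Pe/forall_inP : [set x; y] \in edges G by apply/edgeP; exists x, y.
by apply; rewrite set21.
Qed.

Lemma forall_in_set2 (T : finType) (P : pred T) (x y : T) :
  [forall v in [set x; y], P v] = P x && P y.
Proof.
apply/forall_inP/andP => [Pxy | [Px Py] v].
  by rewrite !Pxy ?set21 ?set22.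
by rewrite !inE => /orP[] /eqP->.
Qed.

Lemma big_set2 (R : Type) (idx : R) (op : Monoid.com_law idx) (T : finType)
    (x y : T) (F : T -> R) :
  x != y -> \big[op/idx]_(v in [set x; y]) F v = op (F x) (F y).
Proof. by move=> xy; rewrite big_setU1 ?inE //= big_set1. Qed.

Lemma edge_deg_ge1 (R : numDomainType) (G : sgraph) (x y : G) :
  adj x y -> 1 <= (deg x)%:R :> R /\ 1 <= (deg y)%:R :> R.
Proof.
move=> xy; rewrite !ler1n (deg_gt0 xy); split=> //.
by rewrite adj_sym in xy; exact: deg_gt0 xy.
Qed.

(** The lower bound is the comparison of [sqrt (d_x d_y)] with [sqrt (1 * 1)]
    on each edge. *)
Lemma harmonic_leif (R : rcfType) (G : sgraph) :
  harmonic R G <= geom_arith R G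
    ?= iff [forall (e | e \in edges G), [forall v in e, deg v == 1%N]].
Proof.
apply: leif_sum => _ /edgeP[x [y xy ->]].
rewrite forall_in_set2 !big_set2 ?adj_neq //= invfM invrK.
have [x1 y1] := edge_deg_ge1 R xy.
have := sqrt_mul_leif ltr01 ltr01 x1 y1.
rewrite mulr1 sqrtr1 ![1 == _%:R]eq_sym !pnatr_eq1 => -[le1 <-].
set s := _ + _; have s0 : 0 < 2 / s.
  by rewrite divr_gt0 ?addr_gt0 // (lt_le_trans ltr01).
split; first by rewrite ler_peMl // ltW.
by rewrite -{1}[2 / s]mul1r (inj_eq (mulIf (lt0r_neq0 s0))).
Qed.

(** The upper bound is the comparison of [sqrt (d_x d_y)] with
    [sqrt (m * m)] on each edge, where [m = #|G|.-1]. *)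
Lemma geom_arith_leif (R : rcfType) (G : sgraph) :
  geom_arith R G <= #|G|.-1%:R * harmonic R G
    ?= iff [forall (e | e \in edges G), [forall v in e, deg v == #|G|.-1]].
Proof.
rewrite /harmonic mulr_sumr; apply: leif_sum => _ /edgeP[x [y xy ->]].
rewrite forall_in_set2 !big_set2 ?adj_neq //= invfM invrK.
have [x1 y1] := edge_deg_ge1 R xy.
have x0 := lt_le_trans ltr01 x1; have y0 := lt_le_trans ltr01 y1.
have dle (v : G) : (deg v)%:R <= #|G|.-1%:R :> R by rewrite ler_nat deg_le.
have := sqrt_mul_leif x0 y0 (dle x) (dle y).
rewrite -expr2 sqrtr_sqr ger0_norm ?ler0n // !eqr_nat => -[le1 <-].
set s := _ + _; have s0 : 0 < 2 / s by rewrite divr_gt0 ?addr_gt0.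
split; first by rewrite ler_pM2r.
by rewrite (inj_eq (mulIf (lt0r_neq0 s0))).
Qed.

(** A vertex of degree [n - 1] is adjacent to every other vertex, so adjacency
    is disequality and any numbering of the vertices is an isomorphism to [K_n]. *)
Lemma isomorphic_completeP (G : sgraph) (n : nat) :
  #|G| = n ->
  isomorphic G (complete_graph n) <-> (forall x : G, deg x = n.-1).
Proof.
move=> Gn; split=> [[f [g fK gK] fmono] x | degG].
  rewrite -Gn -(cardsC1 x); apply: eq_card => y.
  by rewrite !inE -fmono /= /complete_adj (can_eq fK) eq_sym.
exists (fun x => cast_ord Gn (enum_rank x)) => [|x y].
  exists (fun i => enum_val (cast_ord (esym Gn) i)) => [x | i].
    by rewrite cast_ordK enum_rankK.
  by rewrite enum_valK cast_ordKV.
have /setP/(_ y) : [set z | adj x z] = [set~ x].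
  apply/eqP; rewrite eqEcard neighbours_subset cardsC1 Gn -(degG x).
  exact: leqnn.
rewrite !inE /= /complete_adj eq_sym => ->.
by rewrite (inj_eq (@cast_ord_inj _ _ _)) (inj_eq enum_rank_inj).
Qed.

Lemma isomorphic_path2 (G : sgraph) :
  isomorphic G (path_graph 2) <-> isomorphic G (complete_graph 2).
Proof.
have adjE : @path_adj 2 =2 @complete_adj 2.
  by case=> [[|[|?]] ?] // [[|[|?]] ?].
by split=> -[f bij_f fmono]; exists f => // x y; rewrite -fmono /= adjE.
Qed.

(** An edge [xy] whose ends have no other neighbours is closed under adjacency,
    so by connectedness it contains every vertex. *)
Lemma card_connected_deg1 (G : sgraph) :
  is_connected G -> (2 <= #|G|)%N -> (forall x : G, deg x = 1%N) -> #|G| = 2%N.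
Proof.
move=> conn G2 deg1.
have nbr (u v w : G) : adj u v -> adj u w -> w = v.
  have /eqP/cards1P[z /setP Nu] := deg1 u.
  by have := (Nu v, Nu w); rewrite !inE => -[-> ->] /eqP-> /eqP->.
have /card_gt0P[x _] : (0 < #|G|)%N by exact: ltnW.
have [y xy] := connected_neighbour x conn G2.
have xy_closed : closed (@adj G) [set x; y].
  apply: intro_closed; first exact/sym_connect_sym/adj_sym.
  move=> u v uv; rewrite !inE => /orP[] /eqP u_e; move: uv; rewrite u_e.
    by move=> /(nbr _ _ _ xy)->; rewrite eqxx orbT.
  by rewrite adj_sym in xy; move=> /(nbr _ _ _ xy)->; rewrite eqxx.
rewrite -cardsT; transitivity #|[set x; y]|; last by rewrite cards2 adj_neq.
apply: eq_card => z.
by rewrite -(closed_connect xy_closed (conn x z)) set21 inE.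
Qed.

Theorem theorem2p6 (R : rcfType) (G : sgraph) (n : nat)
    (hn : #|G| = n) (hn2 : (2 <= n)%N) (hconn : is_connected G) :
  [/\ harmonic R G <= geom_arith R G <= (n%:R - 1) * harmonic R G,
      harmonic R G = geom_arith R G <-> isomorphic G (path_graph 2)
    & geom_arith R G = (n%:R - 1) * harmonic R G
        <-> isomorphic G (complete_graph n)].
Proof.
have G2 : (2 <= #|G|)%N by rewrite hn.
have [le_HG eq_HG] := harmonic_leif R G.
have [le_GH eq_GH] := geom_arith_leif R G.
have n1 : n%:R - 1 = #|G|.-1%:R :> R by rewrite hn -subn1 natrB // ltnW.
rewrite n1; split; first by rewrite le_HG le_GH.
- suff HK2 : harmonic R G = geom_arith R G <-> isomorphic G (complete_graph 2).
    exact: iff_trans HK2 (iff_sym (isomorphic_path2 G)).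
  split=> [/eqP | iso2].
    rewrite eq_HG => /(forall_edges _ hconn G2) deg1.
    have {}deg1 x : deg x = 1%N := eqP (deg1 x).
    exact/isomorphic_completeP/deg1/card_connected_deg1.
  have card2 : #|G| = 2%N.
    by case: iso2 => f bij_f _; rewrite (bij_eq_card bij_f) card_ord.
  apply/eqP; rewrite eq_HG; apply/(forall_edges _ hconn G2) => x.
  by rewrite (isomorphic_completeP card2).1.
- suff GAdeg : geom_arith R G = #|G|.-1%:R * harmonic R G
      <-> forall x : G, deg x = n.-1.
    exact: iff_trans GAdeg (iff_sym (isomorphic_completeP hn)).
  rewrite -hn.
  split=> [/eqP | degG]; last first.
    apply/eqP; rewrite eq_GH.
    by apply/(forall_edges _ hconn G2) => x; exact/eqP.
  by rewrite eq_GH => /(forall_edges _ hconn G2) degG x; exact/eqP.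
Qed.
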